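(* There is a universal constant $c>0$ such that for every $n$ and every nontrivial monotone graph property $f:\{0,1\}^{\binom{n}{2}}\to\{0,1\}$, we have $\mathrm{Q}(f)\ge c\,n$.
   Context: The input $x\in\{0,1\}^{\binom n2}$ is viewed as the adjacency matrix of an undirected simple graph on vertex set $[n]$: the coordinate indexed by the unordered pair $\{i,j\}$ indicates whether $\{i,j\}$ is an edge. $f$ is a graph property if $f$ is invariant under every relabeling of the vertices (permutation of $[n]$ acting on pairs). $f$ is monotone if $x\le y$ coordinatewise implies $f(x)\le f(y)$. $f$ is nontrivial if it is not constant. $\mathrm{Q}(f)$ is the bounded-error quantum query complexity: the minimum number of queries of a quantum query algorithm that outputs $f(x)$ with probability at least $2/3$ on every input. *)

(* Defs.v *)
From Stdlib Require Import Rdefinitions.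
From HB Require Import structures.
From mathcomp Require Import all_boot all_order all_algebra all_fingroup.
From mathcomp Require Import Rstruct.
From mathcomp Require Import complex.
Set Implicit Arguments. Unset Strict Implicit. Unset Printing Implicit Defensive.
Import GRing.Theory Num.Theory.
Local Open Scope ring_scope.

Definition edge (n : nat) := {A : {set 'I_n} | #|A| == 2%N}.

Definition graph (n : nat) := {ffun edge n -> bool}.

(* Relabeling of a pair by a vertex permutation (the image of a 2-set under
   a permutation is again a 2-set; insubd's default is never used). *)
Definition relabel_edge n (s : {perm 'I_n}) (e : edge n) : edge n :=
  insubd e (s @: val e).

Definition relabel n (s : {perm 'I_n}) (x : graph n) : graph n :=
  [ffun e => x (relabel_edge s e)].

Definition graph_property n (f : graph n -> bool) : Prop :=
  forall (s : {perm 'I_n}) (x : graph n), f (relabel s x) = f x.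

Definition monotone n (f : graph n -> bool) : Prop :=
  forall x y : graph n, (forall e, x e ==> y e) -> (f x ==> f y).

Definition nontrivial n (f : graph n -> bool) : Prop :=
  exists x y : graph n, f x != f y.

(** * Quantum query algorithms (standard XOR-oracle model)

   Basis states |e, b, w> with e a query index (a pair), b an answer bit and
   w in a workspace of arbitrary finite size m. The oracle maps
   |e, b, w> to |e, b xor x_e, w>. An algorithm with T queries is
   U_T O_x U_(T-1) O_x ... O_x U_0 applied to a fixed unit initial state,
   followed by a measurement in the computational basis whose outcome is
   post-processed by an arbitrary function out to a bit. *)

Definition C := R[i].

Definition basis (n m : nat) := (edge n * bool * 'I_m)%type.

Definition dim (n m : nat) := #|{: basis n m}|.

Definition oracle_map n m (x : graph n) (s : basis n m) : basis n m :=
  let: (e, b, w) := s in (e, addb b (x e), w).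

Definition oracle n m (x : graph n) : 'M[C]_(dim n m) :=
  \matrix_(i, j) ((enum_val i == oracle_map x (enum_val j))%:R).

Definition sqmod (a : C) : R := let: Complex re im := a in re ^+ 2 + im ^+ 2.

Definition conjmx d (A : 'M[C]_d) : 'M[C]_d := (map_mx conjc A)^T.

Definition unitary d (U : 'M[C]_d) : Prop := U *m conjmx U = 1%:M.

Definition unit_vector d (v : 'cV[C]_d) : Prop :=
  \sum_(i < d) sqmod (v i 0) = 1.

Fixpoint run n m (U : nat -> 'M[C]_(dim n m)) (psi0 : 'cV[C]_(dim n m))
  (x : graph n) (k : nat) : 'cV[C]_(dim n m) :=
  match k with
  | 0 => U 0%N *m psi0
  | k'.+1 => U k *m (oracle m x *m run U psi0 x k')
  end.

Definition prob_output n m (U : nat -> 'M[C]_(dim n m)) (psi0 : 'cV[C]_(dim n m))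
  (out : basis n m -> bool) (T : nat) (x : graph n) (b : bool) : R :=
  \sum_(i < dim n m | out (enum_val i) == b) sqmod (run U psi0 x T i 0).

(* There is a T-query quantum algorithm computing f with error <= 1/3 on every
   input. Q(f) is the least such T. *)
Definition bounded_error_algorithm n (f : graph n -> bool) (T : nat) : Prop :=
  exists (m : nat) (U : nat -> 'M[C]_(dim n m)) (psi0 : 'cV[C]_(dim n m))
         (out : basis n m -> bool),
    (forall k, (k <= T)%N -> unitary (U k)) /\ unit_vector psi0 /\
    forall x : graph n, 2 / 3 <= prob_output U psi0 out T x (f x).

(* Main.v *)
(** The spectral norm of the sensitivity graph of f, in which a graph x is joined
to those obtained by changing one edge of x and the value f x, is at most O(Q(f))
by the adversary method.  It is at least sqrt |V| as soon as f takes the value 1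
an odd number of times on some subcube with set of free coordinates V: then
f xor parity is not balanced on that subcube, and Huang's signed adjacency matrix
of the cube, whose eigenvalues sqrt |V| and - sqrt |V| have equal multiplicity,
has an eigenvector supported on the larger of the two fibres, along whose edges
f changes.

Such a V with |V| >= (n / 4) ^ 2 comes from the argument of Rivest and Vuillemin:
the count is odd if |V| is a power of 2, f differs at the bottom and the top of
the subcube, and the symmetries of f preserving the subcube act transitively on
V.  Here V is the set of edges between two disjoint sets of vertices A and B, and
the other coordinates are found on a chain from the empty to the complete
graph. *)

From Stdlib Require Import Rdefinitions.
From mathcomp Require Import all_boot all_order all_algebra all_fingroup.
From mathcomp Require Import Rstruct complex.
From mathcomp Require Import zify ring lra.
Require Import Defs.
Set Implicit Arguments. Unset Strict Implicit. Unset Printing Implicit Defensive.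
Import Order.TTheory GRing.Theory Num.Theory.
Local Open Scope ring_scope.
(* Otherwise terms expected in [R] are read in the scope of Stdlib's reals. *)
Bind Scope ring_scope with R.

(** * Parity of a transitively symmetric function on a subcube *)

Definition flip {E : finType} (i : E) (x : {ffun E -> bool}) : {ffun E -> bool} :=
  [ffun e => x e (+) (e == i)].

Definition cube {E : finType} (V : {set E}) (z : {ffun E -> bool}) :
    {set {ffun E -> bool}} :=
  [set x : {ffun E -> bool} | [forall e, (e \notin V) ==> (x e == z e)]].

Lemma cubeP (E : finType) (V : {set E}) (z x : {ffun E -> bool}) :
  reflect (forall e, e \notin V -> x e = z e) (x \in cube V z).
Proof.
rewrite inE; apply: (iffP forallP) => h e; last by apply/implyP => /h ->.
by move/implyP: (h e) => /[apply] /eqP.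
Qed.

Lemma dvdn_pow2_mul_even k w m :
  (0 < w)%N -> (w < 2 ^ k)%N -> (2 ^ k %| w * m)%N -> ~~ odd m.
Proof.
move=> w0 wk h; apply/negP => om.
have co : coprime (2 ^ k) m by rewrite coprimeXl // coprime2n.
move: h; rewrite Gauss_dvdl // => /dvdn_leq => /(_ w0).
by rewrite leqNgt wk.
Qed.

Section OddCube.
Variables (E : finType) (V : {set E}) (z : {ffun E -> bool}).
Variables (f : {ffun E -> bool} -> bool) (k : nat).
Hypothesis cardV : #|V| = (2 ^ k)%N.
Hypothesis f_lo : ~~ f [ffun e => (e \notin V) && z e].
Hypothesis f_hi : f [ffun e => (e \in V) || z e].
Hypothesis f_sym : forall v v', v \in V -> v' \in V -> exists s : E -> E,
  [/\ injective s, s v = v', forall e, (s e \in V) = (e \in V),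
      forall e, e \notin V -> z (s e) = z e
    & forall x : {ffun E -> bool}, f [ffun e => x (s e)] = f x].

Let wt (x : {ffun E -> bool}) := #|[set v in V | x v]|.
Let level (w : nat) := [set x in cube V z | f x && (wt x == w)].

Let wt_le x : (wt x < (2 ^ k).+1)%N.
Proof. by rewrite ltnS -cardV subset_leq_card //; apply/subsetP => e; rewrite inE => /andP[]. Qed.

(** Pulling back along a symmetry taking [v] to [v'] injects the points of the level with x v' = 1
    into those with x v = 1. Used both ways, it shows that all coordinates in [V] are 1 equally
    often on a level. *)
Let level_coord_le w v v' : v \in V -> v' \in V ->
  (#|[set x in level w | x v']| <= #|[set x in level w | x v]|)%N.
Proof.
move=> vV v'V; have [s [sI sv sV sz sf]] := f_sym vV v'V.
pose g (x : {ffun E -> bool}) : {ffun E -> bool} := [ffun e => x (s e)].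
have sbij : bijective s by apply: injF_bij.
have [t st ts] := sbij.
have gI : injective g.
  move=> x y /ffunP h; apply/ffunP => e; move: (h (t e)).
  by rewrite !ffunE ts.
rewrite -(card_imset _ gI); apply/subset_leq_card/subsetP => y /imsetP[x].
rewrite !inE => /andP[/and3P[xc fx /eqP wx] xv'] ->.
rewrite ffunE sv xv' sf fx /= andbT; apply/andP; split.
  move/forallP: xc => xc.
  apply/forallP => e; apply/implyP => eV; rewrite ffunE -(sz _ eV).
  by move: (xc (s e)); rewrite sV eV.
rewrite -wx /wt -[X in _ == X](card_preimset _ sI); apply/eqP/eq_card => e.
by rewrite !inE ffunE sV.
Qed.

Let level_even w : (0 < w)%N -> (w < 2 ^ k)%N -> ~~ odd #|level w|.
Proof.
move=> w0 wk; apply: dvdn_pow2_mul_even w0 wk _.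
have /card_gt0P[v0 v0V] : (0 < #|V|)%N by rewrite cardV expn_gt0.
have -> : (w * #|level w| = \sum_(x in level w) \sum_(v in V) (x v : nat))%N.
  rewrite mulnC -sum_nat_const; apply: eq_bigr => x.
  rewrite inE => /and3P[_ _ /eqP <-]; rewrite /wt -sum1_card [RHS]big_mkcond /=.
  by rewrite big_mkcond /=; apply: eq_bigr => v _; rewrite inE; case: (v \in V); case: (x v).
rewrite exchange_big /=.
rewrite (eq_bigr (fun=> #|[set x in level w | x v0]|)).
  by rewrite sum_nat_const cardV dvdn_mulr.
move=> v vV; transitivity #|[set x in level w | x v]|.
  rewrite -sum1_card big_mkcond [RHS]big_mkcond /=; apply: eq_bigr => x _.
  have -> : (x \in [set y in level w | (y : {ffun E -> bool}) v]) = (x \in level w) && x v by rewrite inE.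
  by case: (x \in level w); case: (x v).
by apply/eqP; rewrite eqn_leq !level_coord_le.
Qed.

(* Counting the pairs (x, v) with x on the w-th level and v in x in two ways
   gives w |level w| = 2 ^ k K, so that all levels but the last are even. *)
Lemma odd_cube : odd #|[set x in cube V z | f x]|.
Proof.
have -> : (#|[set x in cube V z | f x]| = \sum_(w < (2 ^ k).+1) #|level w|)%N.
  rewrite -sum1_card (partition_big (fun x => Ordinal (wt_le x)) xpredT) //=.
  apply: eq_bigr => w _; rewrite -sum1_card; apply: eq_bigl => x.
  by rewrite !inE andbA.
rewrite big_ord_recr /= oddD.
(* The top level is a single point by [f_hi]; the bottom level will be empty by [f_lo]. *)
have -> : #|level (2 ^ k)%N| = 1%N.
  apply/eqP/cards1P; exists [ffun e => (e \in V) || z e].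
  apply/setP => x; rewrite !inE; apply/and3P/eqP => [[xc fx /eqP wx]|->].
    have xV : [set v in V | x v] =i V.
      by apply/subset_cardP; [rewrite -/(wt x) wx cardV | apply/subsetP => e; rewrite inE => /andP[]].
    apply/ffunP => e; rewrite ffunE; case eV : (e \in V) => /=.
      by move: (xV e); rewrite inE eV /= => ->.
    by move/forallP: xc => /(_ e); rewrite eV => /eqP.
  split => //; first by apply/forallP => e; rewrite ffunE; case: (e \in V) => //=.
  rewrite -cardV; apply/eqP/eq_card => e; rewrite !inE ffunE.
  by case: (e \in V).
rewrite addbT; apply/negP.
have : ~~ odd (\sum_(w < 2 ^ k) #|level w|)%N.
  apply: (big_ind (fun m => ~~ odd m)) => // [a b|w _].
    by rewrite oddD => /negbTE -> /negbTE ->.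
  have [w0|w0] := posnP w; last exact: level_even.
  rewrite (_ : level w = set0) ?cards0 //; apply/setP => x.
  rewrite !inE; apply/negP => /and3P[xc fx]; rewrite w0 cards_eq0 => /eqP x0.
  case/negP: f_lo; move: fx; congr (is_true (f _)); apply/ffunP => e; rewrite ffunE.
  move/setP/(_ e): x0; rewrite !inE; case eV: (e \in V) => //=.
  by move/forallP: xc => /(_ e); rewrite eV => /eqP.
by move/negP.
Qed.
End OddCube.

(** * Huang's signed matrix *)

Lemma flipK (E : finType) (i : E) : involutive (flip i).
Proof. by move=> x; apply/ffunP => e; rewrite !ffunE addbK. Qed.

Lemma flipC (E : finType) (i j : E) x : flip i (flip j x) = flip j (flip i x).
Proof. by apply/ffunP => e; rewrite !ffunE addbAC. Qed.

Lemma mem_cube_flip (E : finType) (V : {set E}) z i x :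
  i \in V -> (flip i x \in cube V z) = (x \in cube V z).
Proof.
move=> iV; have h (y : {ffun E -> bool}) : y \in cube V z -> flip i y \in cube V z.
  move/cubeP => yc; apply/cubeP => e eV; rewrite ffunE yc //.
  by case: eqVneq eV => [->|]; rewrite ?iV ?addbF.
by apply/idP/idP => /h //; rewrite flipK.
Qed.

Lemma card_cube_balanced (E : finType) (V : {set E}) z i
    (p : {ffun E -> bool} -> bool) :
  i \in V -> (forall x, p (flip i x) = ~~ p x) ->
  #|[set x in cube V z | p x]| = #|[set x in cube V z | ~~ p x]|.
Proof.
move=> iV pi; rewrite -(card_imset _ (inv_inj (flipK i))); apply: eq_card => x.
rewrite [RHS]inE; apply/imsetP/andP => [[y]|[xc px]].
  by rewrite inE => /andP[yc py] ->; rewrite mem_cube_flip // pi py.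
by exists (flip i x); rewrite ?flipK // inE mem_cube_flip // pi xc px.
Qed.

(** There are fewer equations, indexed by [K], than unknowns, indexed by [H]; a nonzero solution is
    extended by 0 outside [H]. *)
Lemma exists_ker_vector (F : fieldType) (T : finType) (H K : {set T})
    (L : T -> T -> F) :
  (#|K| < #|H|)%N -> exists u : T -> F,
    [/\ exists2 x, x \in H & u x != 0, forall x, x \notin H -> u x = 0
      & forall y, y \in K -> \sum_x u x * L x y = 0].
Proof.
move=> ltKH; pose M : 'M[F]_(#|H|, #|K|) := \matrix_(i, j) L (enum_val i) (enum_val j).
have /row_subPn[k] : ~~ (kermx M <= (0 : 'M[F]_#|H|))%MS.
  rewrite submx0 -mxrank_eq0 mxrank_ker subn_eq0 -ltnNge.
  exact: leq_ltn_trans (rank_leq_col M) ltKH.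
set a := row k (kermx M) => a0; have {a0} a0 : a != 0 by apply: contraNneq a0 => ->; exact: sub0mx.
have aM : a *m M = 0 by rewrite /a -row_mul mulmx_ker row0.
pose u x := \sum_(i < #|H|) (enum_val i == x)%:R * a 0 i.
have uE i : u (enum_val i) = a 0 i.
  rewrite /u (bigD1 i) //= eqxx mul1r big1 ?addr0 // => j ji.
  by rewrite (inj_eq enum_val_inj) (negbTE ji) mul0r.
exists u; split.
- have /rV0Pn[i ai] := a0.
  by exists (enum_val i); rewrite ?enum_valP ?uE.
- move=> x xH; apply: big1 => i _; case: eqVneq => [ex|]; rewrite ?mul0r //.
  by rewrite -ex enum_valP in xH.
move=> y yK; transitivity ((a *m M) 0 (enum_rank_in yK y)); last by rewrite aM mxE.
rewrite mxE (bigID (mem H)) /= [X in _ + X]big1 ?addr0; last first.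
  move=> x xH; rewrite /u big1 ?mul0r // => i _.
  case: eqVneq => [ex|]; rewrite ?mul0r //.
  by rewrite -ex enum_valP in xH.
rewrite big_enum_val /=; apply: eq_bigr => i _.
by rewrite uE; congr (_ * _); rewrite mxE enum_rankK_in.
Qed.

Section Huang.
Variables (R : rcfType) (E : finType) (V : {set E}).
Implicit Types (x y z : {ffun E -> bool}) (u w : {ffun E -> bool} -> R).

(** Jordan-Wigner signs: flipping a coordinate of [V] changes the sign attached to [i] exactly when
    it strictly precedes [i] in the enumeration of [E]. Of two distinct coordinates exactly one
    precedes the other, so signed flips anticommute. *)
Let sgn (i : E) x : R :=
  (-1) ^+ #|[set j in V | (enum_rank j < enum_rank i)%N && x j]|.

Let B u x := \sum_(i in V) sgn i x * u (flip i x).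

Let sgn_flip_ge i j x : (enum_rank i <= enum_rank j)%N ->
  sgn i (flip j x) = sgn i x.
Proof.
move=> ij; congr (_ ^+ _); apply: eq_card => e; rewrite !inE ffunE.
by case: eqVneq => [->|]; rewrite ?addbF // ltnNge ij.
Qed.

Let sgn_flip_lt i j x : j \in V -> (enum_rank j < enum_rank i)%N ->
  sgn i (flip j x) = - sgn i x.
Proof.
move=> jV ji; rewrite /sgn.
set S := [set _ in V | _]; set S' := [set _ in V | _].
have SS' e : e != j -> (e \in S) = (e \in S').
  by move=> /negbTE ej; rewrite !inE ffunE ej addbF.
have Sj : (j \in S) = ~~ (j \in S').
  by rewrite !inE ffunE eqxx jV ji addbT.
rewrite (cardsD1 j S) (cardsD1 j S') Sj.
rewrite (_ : S :\ j = S' :\ j); last first.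
  by apply/setP => e; rewrite !in_setD1; case: eqVneq => //= /SS'.
by case: (j \in S'); rewrite /= ?add0n ?add1n exprS ?mulN1r ?opprK.
Qed.

Let sgn_sqr i x : sgn i x * sgn i x = 1.
Proof. by rewrite -expr2 sqrr_sign. Qed.

(* The summands are signed coordinate flips, which square to 1 and pairwise
   anticommute. *)
Let B_sqr u x : B (B u) x = #|V|%:R * u x.
Proof.
pose t i j := sgn i x * sgn j (flip i x) * u (flip j (flip i x)).
have -> : B (B u) x = \sum_(i in V) (t i i + \sum_(j in V | j != i) t i j).
  apply: eq_bigr => i iV; rewrite mulr_sumr (bigD1 i) //=.
  by congr (_ + _); [|apply: eq_bigr => j _]; rewrite /t mulrA.
rewrite big_split /=.
have -> : \sum_(i in V) t i i = #|V|%:R * u x.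
  rewrite mulr_natl -sumr_const; apply: eq_bigr => i _.
  by rewrite /t sgn_flip_ge // sgn_sqr mul1r flipK.
have anti i j : i \in V -> j \in V -> j != i -> t i j = - t j i.
  rewrite /t flipC => iV jV; rewrite -(inj_eq enum_rank_inj) -(inj_eq val_inj) /=.
  rewrite neq_ltn => /orP[] h.
    by rewrite sgn_flip_ge ?(ltnW h) // [in RHS]sgn_flip_lt //; ring.
  by rewrite sgn_flip_lt // sgn_flip_ge ?(ltnW h) //; ring.
set X := \sum_(i in V) \sum_(j in V | j != i) t i j.
suff : X = - X by lra.
rewrite [in LHS]/X (exchange_big_dep (mem V)) /=; last by move=> i j _ /andP[].
rewrite /X -sumrN; apply: eq_bigr => i iV; rewrite -sumrN.
apply: eq_big => [j|j /andP[jV]]; first by rewrite iV eq_sym.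
by rewrite iV /= => ij; apply: anti.
Qed.

(** The vector is the absolute value of an eigenvector [w] of [B] for the eigenvalue [s], supported
    on a fibre [S] of f xor parity. Parity changes in every direction of [V], so f changes along
    every such edge inside [S]. *)
Lemma odd_cube_spectral z (f : {ffun E -> bool} -> bool) :
  (0 < #|V|)%N -> odd #|[set x in cube V z | f x]| ->
  exists v : {ffun E -> bool} -> R, [/\ forall x, 0 <= v x, 0 < \sum_x v x ^+ 2
    & Num.sqrt #|V|%:R * \sum_x v x ^+ 2 <=
      \sum_x \sum_(i | f x != f (flip i x)) v x * v (flip i x)].
Proof.
move=> /card_gt0P[i0 i0V] fodd; set s := Num.sqrt _.
have s2 : s ^+ 2 = #|V|%:R by rewrite sqr_sqrtr ?ler0n.
pose par x := odd #|[set j in V | x j]|.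
have par_flip i x : i \in V -> par (flip i x) = ~~ par x.
  move=> iV; rewrite /par (cardsD1 i) (cardsD1 i [set j in V | x j]).
  rewrite (_ : [set j in V | (flip i x) j] :\ i = [set j in V | x j] :\ i); last first.
    by apply/setP => e; rewrite !inE ffunE; case: eqVneq; rewrite ?addbF.
  by rewrite !inE iV ffunE eqxx addbT !oddD !oddb; case: (x i); rewrite /= ?negbK.
pose H := [set x in cube V z | ~~ x i0].
have cH : #|cube V z| = (#|H| + #|H|)%N.
  have HE : #|H| = #|[set x in cube V z | ~~ ~~ x i0]|.
    by apply: (card_cube_balanced z i0V) => x; rewrite ffunE eqxx addbT.
  rewrite -(cardsID [set x : {ffun E -> bool} | ~~ x i0] (cube V z)) {2}HE.
  by congr (_ + _)%N; apply: eq_card => x; rewrite !inE // andbC.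
(* Parity being balanced, f xor parity holds at |H| + #f - 2 #(f and parity) points. Since #f is odd
   this is not |H|, half of the cube, so one of the two fibres is smaller than [H]. *)
have [b bS] : exists b, (#|[set x in cube V z | f x (+) par x != b]| < #|H|)%N.
  pose N (p : pred {ffun E -> bool}) := #|[set x in cube V z | p x]|.
  have split p q : N p = (N (fun x => p x && q x) + N (fun x => p x && ~~ q x))%N.
    rewrite /N -(cardsID [set x | q x]).
    by congr (_ + _)%N; apply: eq_card => x; rewrite !inE; case: (p x); case: (q x); rewrite ?andbT ?andbF.
  have Next p q : p =1 q -> N p = N q.
    by move=> pq; apply: eq_card => x; rewrite !inE pq.
  have cubeE : #|cube V z| = N xpredT by apply: eq_card => x; rewrite !inE andbT.
  have xorE b : N (fun x => f x (+) par x != b) =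
      (N (fun x => f x && (par x == b)) + N (fun x => ~~ f x && (par x == ~~ b)))%N.
    rewrite (split _ f); congr (_ + _)%N; apply: Next => x;
      by case: (f x); case: (par x); case: b.
  have Ef := split f par.
  have Epar := split par f.
  have Enpar := split (fun x => ~~ par x) f.
  have ET : N xpredT = (N par + N (fun x => ~~ par x))%N := split xpredT par.
  have bal : N par = N (fun x => ~~ par x).
    by apply: (card_cube_balanced z i0V) => x; exact: par_flip.
  have Nodd : odd (N f) by [].
  have E1 := xorE true; have E2 := xorE false.
  have F1 : N (fun x => f x && (par x == true)) = N (fun x => f x && par x).
    by apply: Next => x; rewrite eqb_id.
  have F2 : N (fun x => ~~ f x && (par x == true)) = N (fun x => par x && ~~ f x).
    by apply: Next => x; rewrite eqb_id andbC.
  have F3 : N (fun x => f x && (par x == false)) = N (fun x => f x && ~~ par x).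
    by apply: Next => x; rewrite eqbF_neg.
  have F4 : N (fun x => ~~ f x && (par x == false)) = N (fun x => ~~ par x && ~~ f x).
    by apply: Next => x; rewrite eqbF_neg andbC.
  have F5 : N (fun x => par x && f x) = N (fun x => f x && par x).
    by apply: Next => x; rewrite andbC.
  have F6 : N (fun x => ~~ par x && f x) = N (fun x => f x && ~~ par x).
    by apply: Next => x; rewrite andbC.
  case: (ltnP (N (fun x => f x (+) par x != true)) #|H|) => [|h1]; first by exists true.
  case: (ltnP (N (fun x => f x (+) par x != false)) #|H|) => [|h2]; first by exists false.
  exfalso; move: E1 E2 Ef Epar Enpar ET cH cubeE Nodd h1 h2 bal.
  rewrite F1 F2 F3 F4 F5 F6; clearbody N; clear; lia.
pose S := [set x in cube V z | f x (+) par x == b].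
pose K := [set x in cube V z | f x (+) par x != b].
pose L x y := \sum_(i in V) sgn i y * (x == flip i y)%:R + s * (x == y)%:R.
have [u [[x0 x0H ux0] uH uK]] := @exists_ker_vector R _ H K L bS.
(* Since B^2 = s^2, applying B + s always lands in the eigenspace of [s]. The equations indexed by
   [K] make [w] vanish outside [S]. *)
pose w y := B u y + s * u y.
have wE y : w y = \sum_x u x * L x y.
  have pick c a : \sum_x u x * (c * (x == a)%:R) = c * u a.
    rewrite (bigD1 a) //= eqxx big1 ?addr0 => [|x /negbTE ->]; last by rewrite !mulr0.
    by rewrite mulr1 mulrC.
  under eq_bigr do rewrite mulrDr mulr_sumr.
  rewrite big_split /= pick exchange_big /=; congr (_ + _).
  by apply: eq_bigr => i _; rewrite pick.
have Bw y : B w y = s * w y.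
  rewrite /w mulrDr mulrA -expr2 s2 -B_sqr [RHS]addrC mulr_sumr /B -big_split /=.
  by apply: eq_bigr => i _; rewrite mulrDr; congr (_ + _); ring.
have u_cube y : y \notin cube V z -> u y = 0.
  by move=> yc; apply: uH; rewrite inE (negbTE yc).
have wS y : y \notin S -> w y = 0.
  have [yc yS|yc _] := boolP (y \in cube V z).
    by rewrite wE uK // inE yc; move: yS; rewrite inE yc.
  rewrite /w u_cube // mulr0 addr0 /B big1 // => i iV.
  by rewrite u_cube ?mulr0 // mem_cube_flip.
(* This point and all its neighbours in directions of [V] except [x0] have coordinate [i0] equal to
   1, so [u] vanishes there and only [u x0] remains, up to sign. *)
have w_neq0 : w (flip i0 x0) != 0.
  move: (x0H); rewrite inE => /andP[_ x0i0].
  rewrite /w /B (bigD1 i0) //= flipK big1 => [|i /andP[iV ii0]].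
    rewrite (uH (flip i0 x0)) ?inE ?ffunE ?eqxx ?(negbTE x0i0) ?andbF //.
    by rewrite mulr0 !addr0 mulf_neq0 // signr_eq0.
  rewrite uH ?mulr0 // inE !ffunE eqxx (negbTE x0i0) eq_sym (negbTE ii0).
  by rewrite andbF.
exists (fun x => `|w x|); split => //.
- rewrite (bigD1 (flip i0 x0)) //= ltr_pwDl //.
    by rewrite exprn_gt0 // normr_gt0.
  by apply: sumr_ge0 => x _; rewrite sqr_ge0.
rewrite mulr_sumr; apply: ler_sum => y _.
rewrite real_normK ?num_real // expr2 mulrCA -Bw mulr_sumr.
rewrite big_mkcond [leRHS]big_mkcond /=; apply: ler_sum => i _.
rewrite -normrM; case: ifPn => iV; last by case: ifP.
rewrite mulrCA; case: ifPn => [_|/negPn/eqP ff].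
  apply: le_trans (ler_norm _) _.
  by rewrite (normrM (sgn i y)) /sgn normrX normrN1 expr1n mul1r.
suff -> : w y * w (flip i y) = 0 by rewrite mulr0.
have [yS|/wS ->] := boolP (y \in S); last by rewrite mul0r.
rewrite (wS (flip i y)) ?mulr0 //.
move: yS; rewrite inE => /andP[yc /eqP yb].
rewrite inE mem_cube_flip // yc -ff par_flip // -yb.
by case: (f y); case: (par y).
Qed.
End Huang.

(** * The adversary bound *)

Lemma sqmodE (a : C) : sqmod a = complex.Re a ^+ 2 + complex.Im a ^+ 2.
Proof. by case: a. Qed.

(** Real parts of Hermitian products suffice for the adversary argument, so complex vectors are
    treated as real ones of twice the dimension. *)
Definition cdot (a b : C) : R := complex.Re a * complex.Re b + complex.Im a * complex.Im b.

Definition rdot d (a b : 'cV[C]_d) : R := \sum_i cdot (a i 0) (b i 0).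

Lemma cdotE a b : cdot a b = complex.Re (conjc a * b).
Proof. by case: a b => [a1 a2] [b1 b2]; rewrite /cdot /=; ring. Qed.

Lemma cdotxx a : cdot a a = sqmod a.
Proof. by rewrite sqmodE /cdot -!expr2. Qed.

Lemma sqmod_ge0 a : 0 <= sqmod a.
Proof. by rewrite sqmodE addr_ge0 ?sqr_ge0. Qed.

Lemma cdot_young (t : R) a b : 0 < t -> 2 * cdot a b <= t * sqmod a + t^-1 * sqmod b.
Proof.
move=> t0; rewrite !sqmodE; case: a b => [a1 a2] [b1 b2]; rewrite /cdot /= -subr_ge0.
have -> : t * (a1 ^+ 2 + a2 ^+ 2) + t^-1 * (b1 ^+ 2 + b2 ^+ 2) - 2 * (a1 * b1 + a2 * b2)
   = t * ((a1 - b1 / t) ^+ 2 + (a2 - b2 / t) ^+ 2).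
  by field; rewrite gt_eqF.
by apply: mulr_ge0; [exact: ltW | apply: addr_ge0; exact: sqr_ge0].
Qed.

(** The arithmetic-geometric mean inequality for each product. Later [b] and [c] are the amplitudes
    of two basis states differing in the answer bit. *)
Lemma cdot_sub_le (p q : R) a b c :
  p * q * (cdot a b - cdot a c) <= p ^+ 2 * sqmod a + 2^-1 * (q ^+ 2 * (sqmod b + sqmod c)).
Proof.
rewrite !sqmodE; case: a b c => [a1 a2] [b1 b2] [c1 c2]; rewrite /cdot /=.
have := sqr_ge0 (p * a1 - q * b1); have := sqr_ge0 (p * a2 - q * b2).
have := sqr_ge0 (p * a1 + q * c1); have := sqr_ge0 (p * a2 + q * c2).
by lra.
Qed.

Lemma rdotE d (a b : 'cV[C]_d) :
  rdot a b = complex.Re (((map_mx conjc a)^T *m b) 0 0).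
Proof.
have ReD : {morph @complex.Re R : x y / x + y} by move=> [? ?] [? ?].
rewrite mxE (@big_morph _ _ _ 0 _ 0 _ ReD) //; apply: eq_bigr => i _.
by rewrite cdotE !mxE.
Qed.

Lemma rdot_unitary d (U : 'M[C]_d) a b : unitary U -> rdot (U *m a) (U *m b) = rdot a b.
Proof.
move=> /mulmx1C UU; rewrite !rdotE map_mxM trmx_mul -mulmxA.
by rewrite (mulmxA _ U) -/(conjmx U) UU mul1mx.
Qed.

Lemma rdot_basis n m (a b : 'cV[C]_(dim n m)) :
  rdot a b = \sum_(s : basis n m) cdot (a (enum_rank s) 0) (b (enum_rank s) 0).
Proof.
rewrite /rdot (reindex enum_rank) //=.
by exists enum_val => ? _; rewrite ?enum_rankK ?enum_valK.
Qed.

Lemma oracle_mapK n m (x : graph n) : involutive (@oracle_map n m x).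
Proof. by move=> [[e b] w] /=; rewrite addbK. Qed.

Lemma oracleE n m (x : graph n) (a : 'cV[C]_(dim n m)) s :
  (oracle m x *m a) (enum_rank s) 0 = a (enum_rank (oracle_map x s)) 0.
Proof.
rewrite mxE (bigD1 (enum_rank (oracle_map x s))) //= big1 => [|j js].
  by rewrite mxE !enum_rankK oracle_mapK eqxx mul1r addr0.
rewrite mxE enum_rankK; case: eqVneq => [sj|]; last by rewrite mul0r.
by rewrite sj oracle_mapK enum_valK eqxx in js.
Qed.

Definition query_mass n m (e : edge n) (a : 'cV[C]_(dim n m)) : R :=
  \sum_(s : basis n m | s.1.1 == e) sqmod (a (enum_rank s) 0).

Lemma query_mass_ge0 n m (e : edge n) (a : 'cV[C]_(dim n m)) : 0 <= query_mass e a.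
Proof. by apply: sumr_ge0 => s _; exact: sqmod_ge0. Qed.

Lemma sum_query_mass n m (a : 'cV[C]_(dim n m)) :
  \sum_e query_mass e a = rdot a a.
Proof.
rewrite rdot_basis (partition_big (fun s : basis n m => s.1.1) xpredT) //=.
by apply: eq_bigr => e _; apply: eq_bigr => s _; rewrite cdotxx.
Qed.

Lemma rdot_oracle n m (x : graph n) (a b : 'cV[C]_(dim n m)) :
  rdot (oracle m x *m a) (oracle m x *m b) = rdot a b.
Proof.
rewrite !rdot_basis [RHS](reindex_inj (inv_inj (oracle_mapK x))) /=.
by apply: eq_bigr => s _; rewrite !oracleE.
Qed.

(* The two oracles differ only on the basis states that query e. *)
Lemma rdot_oracle_flip n m (x : graph n) e (a b : 'cV[C]_(dim n m)) (p q : R) :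
  p * q * (rdot a b - rdot (oracle m x *m a) (oracle m (flip e x) *m b)) <=
  p ^+ 2 * query_mass e a + q ^+ 2 * query_mass e b.
Proof.
(* [tau] is the composition of the two oracle maps. *)
pose tau (s : basis n m) : basis n m := let: (e', c, w) := s in (e', c (+) (e' == e), w).
have tauK : involutive tau by move=> [[e' c] w] /=; rewrite addbK.
have -> : rdot (oracle m x *m a) (oracle m (flip e x) *m b) =
    \sum_(s : basis n m) cdot (a (enum_rank s) 0) (b (enum_rank (tau s)) 0).
  rewrite rdot_basis (reindex_inj (inv_inj (oracle_mapK x))) /=.
  apply: eq_bigr => s _; rewrite !oracleE oracle_mapK; congr (cdot _ (b (enum_rank _) 0)).
  by case: s => [[e' c] w] /=; rewrite ffunE addbA addbK.
rewrite rdot_basis -sumrB mulr_sumr (bigID (fun s : basis n m => s.1.1 == e)) /=.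
rewrite [X in _ + X]big1 ?addr0; last first.
  by move=> [[e' c] w] /= /negbTE ee; rewrite /tau ee addbF subrr mulr0.
(* [tau] permutes the states that query [e], so the mass can be averaged over each state and its
   image, to match [cdot_sub_le]. *)
have -> : query_mass e b = 2^-1 * \sum_(s : basis n m | s.1.1 == e)
    (sqmod (b (enum_rank s) 0) + sqmod (b (enum_rank (tau s)) 0)).
  rewrite big_split /=.
  have -> : \sum_(s : basis n m | s.1.1 == e) sqmod (b (enum_rank (tau s)) 0) =
      query_mass e b.
    rewrite /query_mass [RHS](reindex_inj (inv_inj tauK)) /=.
    by apply: eq_bigl => -[[e' c] w].
  rewrite -/(query_mass e b); lra.
rewrite mulrCA !mulr_sumr -big_split /=; apply: ler_sum => s _.
exact: cdot_sub_le.
Qed.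

Section Adversary.
Variables (n : nat) (f : graph n -> bool) (m : nat) (U : nat -> 'M[C]_(dim n m)).
Variables (psi0 : 'cV[C]_(dim n m)) (out : basis n m -> bool) (T : nat).
Hypothesis U_unitary : forall k, (k <= T)%N -> unitary (U k).
Hypothesis psi0_unit : unit_vector psi0.
Hypothesis correct : forall x, 2 / 3 <= prob_output U psi0 out T x (f x).
Variable v : graph n -> R.
Hypothesis v_ge0 : forall x, 0 <= v x.

Let psi x k := run U psi0 x k.

Let psi_norm x k : (k <= T)%N -> rdot (psi x k) (psi x k) = 1.
Proof.
elim: k => [|k IH] kT; rewrite rdot_unitary; try exact: U_unitary.
  by rewrite -psi0_unit; apply: eq_bigr => i _; rewrite cdotxx.
by rewrite rdot_oracle IH // ltnW.
Qed.

(* The weights in [cdot_young] are chosen so that the bound is 17/18 < 1. *)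
Let psi_final x y : f x != f y -> rdot (psi x T) (psi y T) <= 17 / 18.
Proof.
move=> fxy; pose P z b := \sum_(i < dim n m | out (enum_val i) == b) sqmod (psi z T i 0).
have total z : P z (f x) + P z (f y) = 1.
  rewrite -(psi_norm z (leqnn T)) /rdot (bigID (fun i => out (enum_val i) == f x)) /=.
  congr (_ + _); first by apply: eq_bigr => i _; rewrite cdotxx.
  apply: eq_big => [i|i _]; last by rewrite cdotxx.
  by move: fxy; case: (out _); case: (f x); case: (f y).
have hx : 2 / 3 <= P x (f x) by exact: correct.
have hy : 2 / 3 <= P y (f y) by exact: correct.
have tx := total x; have ty := total y.
suff : 2 * rdot (psi x T) (psi y T) <=
  (2 / 3 * P x (f x) + (2 / 3)^-1 * P y (f x)) +
  (3 / 2 * P x (f y) + (3 / 2)^-1 * P y (f y)) by lra.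
rewrite /rdot (bigID (fun i => out (enum_val i) == f x)) /= mulrDr.
rewrite !mulr_sumr -!big_split /=; apply: lerD.
  by apply: ler_sum => i _; apply: cdot_young; lra.
rewrite (eq_bigl (fun i => out (enum_val i) == f y)).
  by apply: ler_sum => i _; apply: cdot_young; lra.
by move=> i; move: fxy; case: (out _); case: (f x); case: (f y).
Qed.

(** The progress measure of the adversary method. Before the first query all runs coincide; at the
    end the runs on [x] and [flip e x] must be distinguishable. *)
Let W k := \sum_x \sum_(e | f x != f (flip e x))
  v x * v (flip e x) * rdot (psi x k) (psi (flip e x) k).

(** With p = v x and q = v (flip e x), the loss at an edge is bounded by two weighted query masses.
    The masses of a unit vector sum to 1 over all [e], and the involution [flip e] makes the two
    halves equal. *)
Let W_step k : (k < T)%N -> W k - W k.+1 <= 2 * \sum_x v x ^+ 2.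
Proof.
move=> kT; pose M x := \sum_e v x ^+ 2 * query_mass e (psi x k).
have ME x : M x = v x ^+ 2.
  by rewrite /M -mulr_sumr sum_query_mass psi_norm ?mulr1 // ltnW.
apply: le_trans (_ : \sum_x \sum_e (v x ^+ 2 * query_mass e (psi x k) +
    v (flip e x) ^+ 2 * query_mass e (psi (flip e x) k)) <= _).
  rewrite -sumrB; apply: ler_sum => x _; rewrite -sumrB big_mkcond /=.
  apply: ler_sum => e _; case: ifP => _.
    by rewrite -mulrBr /psi /= rdot_unitary; [exact: rdot_oracle_flip | exact: U_unitary].
  by rewrite addr_ge0 // mulr_ge0 ?sqr_ge0 ?query_mass_ge0.
under eq_bigr do rewrite big_split /= -/(M _) ME.
rewrite big_split /= mulr2n mulrDl !mul1r lerD2l exchange_big /=.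
rewrite le_eqVlt; apply/orP; left; apply/eqP.
transitivity (\sum_x M x); last by apply: eq_bigr.
rewrite /M [RHS]exchange_big /=; apply: eq_bigr => e _.
by rewrite [RHS](reindex_inj (inv_inj (flipK e))).
Qed.

(** At least 1/18 of the initial value must be lost, and [T] queries lose at most 2 T times the
    squared norm of [v]; hence 36 = 18 * 2. *)
Lemma adversary_bound :
  \sum_x \sum_(e | f x != f (flip e x)) v x * v (flip e x) <=
  36 * T%:R * \sum_x v x ^+ 2.
Proof.
set L := \sum_x _.
have W0 : W 0%N = L.
  apply: eq_bigr => x _; apply: eq_bigr => e _.
  by rewrite (_ : rdot _ _ = 1) ?mulr1 //; exact: (psi_norm x (leq0n T)).
have WT : W T <= 17 / 18 * L.
  rewrite mulr_sumr; apply: ler_sum => x _; rewrite mulr_sumr; apply: ler_sum => e fe.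
  by rewrite mulrC ler_wpM2r ?mulr_ge0 // psi_final.
have Wk k : (k <= T)%N -> W 0%N - W k <= k%:R * (2 * \sum_x v x ^+ 2).
  elim: k => [|k IH] kT; first by rewrite subrr mul0r.
  have -> : W 0%N - W k.+1 = (W 0%N - W k) + (W k - W k.+1) by ring.
  by rewrite -natr1 mulrDl mul1r; apply: lerD; [exact: IH (ltnW kT) | exact: W_step].
have := Wk T (leqnn T); rewrite W0; set N := \sum_x v x ^+ 2 => h.
have -> : 36 * T%:R * N = 18 * (T%:R * (2 * N)) by ring.
by move: h WT; set a := T%:R * _; lra.
Qed.
End Adversary.

(** * Bicliques as sets of free edges *)

(** [r] need not be symmetric: an edge is present as soon as [r] holds in one of the two orders. *)
Definition mkgraph n (r : rel 'I_n) : graph n :=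
  [ffun e : edge n => [exists i in val e, exists j in val e, (i != j) && r i j]].

Lemma mkgraphP n (r : rel 'I_n) (e : edge n) :
  reflect (exists i j, [/\ i \in val e, j \in val e, i != j & r i j]) (mkgraph r e).
Proof.
rewrite ffunE; apply: (iffP exists_inP) => [[i ie /exists_inP[j je /andP[ij rij]]]|].
  by exists i, j.
by move=> [i [j [ie je ij rij]]]; exists i => //; apply/exists_inP; exists j; rewrite ?ij.
Qed.

Lemma mkgraph_mono n (f : graph n -> bool) (r r' : rel 'I_n) : monotone f ->
  (forall i j, i != j -> r i j -> r' i j || r' j i) -> f (mkgraph r) -> f (mkgraph r').
Proof.
move=> mf rr'; apply/implyP/mf => e; apply/implyP => /mkgraphP[i [j [ie je ij rij]]].
apply/mkgraphP; case/orP: (rr' i j ij rij) => h; first by exists i, j.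
by exists j, i; rewrite eq_sym.
Qed.

Lemma val_relabel_edge n (s : {perm 'I_n}) (e : edge n) :
  val (relabel_edge s e) = s @: val e.
Proof. by rewrite /relabel_edge val_insubd card_imset ?(valP e) //; exact: perm_inj. Qed.

Lemma relabel_edge_inj n (s : {perm 'I_n}) : injective (relabel_edge s).
Proof.
move=> e e' /(congr1 val); rewrite !val_relabel_edge => /(imset_inj (@perm_inj _ s)).
exact: val_inj.
Qed.

Lemma mkgraph_relabel n (s : {perm 'I_n}) (r r' : rel 'I_n) e :
  (forall i j, r (s i) (s j) = r' i j) ->
  mkgraph r (relabel_edge s e) = mkgraph r' e.
Proof.
move=> rs; apply/mkgraphP/mkgraphP => -[i [j []]]; rewrite val_relabel_edge.
  move=> /imsetP[i' ie ->] /imsetP[j' je ->]; rewrite (inj_eq perm_inj) rs => ij r'ij.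
  by exists i', j'.
move=> ie je ij; rewrite -rs => rij; exists (s i), (s j).
by rewrite !imset_f ?(inj_eq perm_inj).
Qed.

Lemma graph_property_mkgraph n (f : graph n -> bool) (s : {perm 'I_n}) (r : rel 'I_n) :
  graph_property f -> f (mkgraph (fun i j => r (s i) (s j))) = f (mkgraph r).
Proof.
move=> fP; rewrite -(fP s (mkgraph r)); congr (f _); apply/ffunP => e.
by rewrite [RHS]ffunE; apply/esym/mkgraph_relabel.
Qed.

Definition biclique n (A B : {set 'I_n}) : rel 'I_n := fun i j => (i \in A) && (j \in B).

Definition odd_subcube n (f : graph n -> bool) (N : nat) : Prop :=
  exists (V : {set edge n}) (z : graph n),
    (N <= #|V|)%N /\ odd #|[set x in cube V z | f x]|.

Lemma biclique_card n (A B : {set 'I_n}) : [disjoint A & B] ->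
  #|[set e | mkgraph (biclique A B) e]| = (#|A| * #|B|)%N.
Proof.
move=> dAB; have nAB i : i \in A -> i \in B -> False.
  by move=> iA iB; move/pred0P: dAB => /(_ i) /=; rewrite iA iB.
rewrite -cardsX -(card_imset _ (val_inj : injective (val : edge n -> _))).
have gI : {in setX A B &, injective (fun p : 'I_n * 'I_n => [set p.1; p.2])}.
  move=> [a b] [a' b'] /setXP[/= aA bB] /setXP[/= a'A b'B] /setP eq2.
  have := eq2 a; rewrite !inE eqxx /= => /esym/orP[] /eqP ea; last by case: (nAB a aA); rewrite ea.
  have := eq2 b; rewrite !inE eqxx orbT => /esym/orP[] /eqP eb; first by case: (nAB b _ bB); rewrite eb.
  by rewrite ea eb.
rewrite -(card_in_imset gI); apply: eq_card => S; apply/imsetP/imsetP.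
  move=> [e]; rewrite inE => /mkgraphP[a [b [ae be ab /andP[aA bB]]]] ->.
  exists (a, b); first exact/setXP.
  apply/esym/eqP; rewrite eqEcard cards2 ab (eqP (valP e)) leqnn andbT.
  by apply/subsetP => c; rewrite !inE => /orP[] /eqP ->.
move=> [[a b] /setXP[/= aA bB] ->].
have ab : a != b by apply/eqP => ab; case: (nAB a); rewrite // ab.
have c2 : #|[set a; b]| == 2%N by rewrite cards2 ab.
exists (Sub [set a; b] c2 : edge n); last by rewrite SubK.
rewrite inE; apply/mkgraphP; exists a, b; rewrite SubK !inE !eqxx orbT.
by split => //; exact/andP.
Qed.

(** This is [odd_cube] with the edges between [A] and [B] free and the others frozen as in [r]. The
    bottom of the subcube lies below the graph of [r], so by monotonicity f is false there. *)
Lemma odd_subcube_biclique n (f : graph n -> bool) (r : rel 'I_n) (A B : {set 'I_n}) a b :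
  graph_property f -> monotone f -> [disjoint A & B] ->
  #|A| = (2 ^ a)%N -> #|B| = (2 ^ b)%N ->
  ~~ f (mkgraph r) -> f (mkgraph (fun i j => r i j || biclique A B i j)) ->
  (forall i i' j j', i \in A -> i' \in A -> j \in B -> j' \in B -> exists s : {perm 'I_n},
    [/\ s i = i', s j = j', forall l, (s l \in A) = (l \in A),
        forall l, (s l \in B) = (l \in B) & forall l m, r (s l) (s m) = r l m]) ->
  odd_subcube f (2 ^ (a + b)).
Proof.
move=> fP fm dAB cA cB flo fhi trans; set V := [set e | mkgraph (biclique A B) e].
have cV : #|V| = (2 ^ (a + b))%N by rewrite biclique_card // cA cB expnD.
exists V, (mkgraph r); rewrite cV; split => //; apply: odd_cube cV _ _ _.
- apply: contra flo; apply/implyP/fm => e; rewrite ffunE; apply/implyP.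
  by case/andP.
- move: fhi; congr (is_true (f _)); apply/ffunP => e; rewrite [RHS]ffunE inE.
  apply/mkgraphP/orP => [[i [j [ie je ij /orP[]]]] h|[] /mkgraphP[i [j [ie je ij h]]]].
  + by right; apply/mkgraphP; exists i, j.
  + by left; apply/mkgraphP; exists i, j.
  + by exists i, j; rewrite h orbT.
  + by exists i, j; rewrite h.
move=> e e'; rewrite !inE => /mkgraphP[i [j [ie je ij /andP[iA jB]]]].
move=> /mkgraphP[i' [j' [ie' je' ij' /andP[iA' jB']]]].
have [s [si sj sA sB sr]] := trans i i' j j' iA iA' jB jB'.
exists (relabel_edge s); split.
- exact: relabel_edge_inj.
- have edgeE (c : edge n) k l : k \in val c -> l \in val c -> k != l -> val c = [set k; l].
    move=> kc lc kl; apply/esym/eqP; rewrite eqEcard cards2 kl (eqP (valP c)) leqnn andbT.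
    by apply/subsetP => x; rewrite !inE => /orP[] /eqP ->.
  apply/val_inj; rewrite val_relabel_edge (edgeE e i j) // (edgeE e' i' j') //.
  by rewrite imsetU !imset_set1 si sj.
- move=> c; rewrite !inE; apply: mkgraph_relabel => k l.
  by rewrite /biclique sA sB.
- by move=> c _; exact: mkgraph_relabel.
by move=> x; rewrite -(fP s x).
Qed.

(* Transpositions give the transitivity when [r] does not distinguish the
   vertices of [A], nor those of [B]. *)
Lemma odd_subcube_homogeneous n (f : graph n -> bool) (r : rel 'I_n) (A B : {set 'I_n})
    (T : eqType) (ty : 'I_n -> T) (r0 : rel T) a b (tA tB : T) :
  graph_property f -> monotone f -> [disjoint A & B] ->
  #|A| = (2 ^ a)%N -> #|B| = (2 ^ b)%N ->
  ~~ f (mkgraph r) -> f (mkgraph (fun i j => r i j || biclique A B i j)) ->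
  (forall i j, r i j = r0 (ty i) (ty j)) ->
  (forall i, (i \in A) = (ty i == tA)) ->  (forall i, (i \in B) = (ty i == tB)) ->
  odd_subcube f (2 ^ (a + b)).
Proof.
move=> fP fm dAB cA cB flo fhi rE AE BE.
apply: (odd_subcube_biclique fP fm dAB cA cB flo fhi) => i i' j j' iA iA' jB jB'.
have nAB k l : k \in A -> l \in B -> k != l.
  move=> kA lB; apply/eqP => kl; move/pred0P: dAB => /(_ k) /=.
  by rewrite kA kl lB.
pose s := (tperm i i' * tperm j j')%g.
have sty l : ty (s l) = ty l.
  rewrite /s permM; move: iA iA' jB jB'; rewrite !AE !BE => /eqP ti /eqP ti' /eqP tj /eqP tj'.
  by case: (tpermP i i' l) => [->|->|_ _]; case: tpermP => [|| _ _];
    try (move=> e; rewrite -?e); congruence.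
exists s; split.
- by rewrite /s permM tpermL tpermD // eq_sym nAB.
- by rewrite /s permM (tpermD (nAB _ _ iA jB)) ?nAB // tpermL.
- by move=> l; rewrite !AE sty.
- by move=> l; rewrite !BE sty.
by move=> l m; rewrite !rE !sty.
Qed.

Lemma odd_subcube_le n (f : graph n -> bool) M N :
  (M <= N)%N -> odd_subcube f N -> odd_subcube f M.
Proof. by move=> MN [V [z [NV h]]]; exists V, z; split=> //; exact: leq_trans NV. Qed.

Lemma card_ord_interval n a b : (b <= n)%N -> #|[set i : 'I_n | a <= i < b]%N| = (b - a)%N.
Proof.
move=> bn; have ltn (j : 'I_(b - a)) : (a + j < n)%N by have := ltn_ord j; lia.
have gI : injective (fun j => Ordinal (ltn j)) by move=> j j' [] /addnI /val_inj.
rewrite -[RHS]card_ord -(card_imset _ gI); apply: eq_card => i; rewrite inE.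
apply/idP/imsetP => [/andP[ai ib]|[j _ ->]]; last by have := ltn_ord j; rewrite /=; lia.
have lt : (i - a < b - a)%N by lia.
by exists (Ordinal lt) => //; apply/val_inj; rewrite /= subnKC.
Qed.

(** * Chains from the empty to the complete graph *)

Section Cases.
Variables (n k : nat) (f : graph n -> bool).
Hypotheses (fP : graph_property f) (fm : monotone f).
Let Q := (2 ^ k)%N.
Let P := (2 ^ k.+1)%N.
Hypotheses (Pn : (P <= n)%N) (nP : (n < 2 * P)%N).

Let PQ : P = (2 * Q)%N. Proof. by rewrite /P expnS. Qed.

(** If n - P <= Q, one biclique between the last and the first [Q] vertices bridges the two graphs.
    Otherwise two bicliques, each joining [Q] vertices to the first [P], are tried in turn. *)
Lemma odd_subcube_threshold :
  ~~ f (mkgraph (fun i j => (i < P) && (j < P))%N) ->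
  f (mkgraph (fun i j => (i < n - P) || (j < n - P))%N) ->
  odd_subcube f (2 ^ (k + k)).
Proof.
move=> f0 f1; have [rQ|Qr] := leqP (n - P) Q.
  pose A := [set i : 'I_n | n - Q <= i < n]%N; pose B := [set i : 'I_n | 0 <= i < Q]%N.
  apply: (@odd_subcube_homogeneous n f (fun i j => (i < n - Q) && (j < n - Q))%N A B _
    (fun i => (i < Q, n - Q <= i))%N (fun t t' => ~~ t.2 && ~~ t'.2) k k
    (false, true) (true, false)) => //.
  - by apply/pred0P => i; rewrite /= !inE; lia.
  - by rewrite card_ord_interval // subKn //; lia.
  - by rewrite card_ord_interval ?subn0 //; lia.
  - by apply: contra f0; apply: mkgraph_mono => // i j _ /andP[h1 h2]; apply/orP; left; lia.
  - apply: mkgraph_mono f1 => // i j _; rewrite /biclique !inE.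
    by have := ltn_ord i; have := ltn_ord j; lia.
  - by move=> i j /=; lia.
  - by move=> i; rewrite inE xpair_eqE; have := ltn_ord i; lia.
  - by move=> i; rewrite inE xpair_eqE; have := ltn_ord i; lia.
apply: (@odd_subcube_le _ _ _ (2 ^ (k + k.+1))); first by rewrite leq_exp2l // addnS.
pose B := [set i : 'I_n | 0 <= i < P]%N.
have cB : #|B| = (2 ^ k.+1)%N by rewrite card_ord_interval // subn0.
pose A1 := [set i : 'I_n | P <= i < P + Q]%N.
have [f2|f2] := boolP (f (mkgraph (fun i j => ((i < P) && (j < P))%N || biclique A1 B i j))).
  apply: (@odd_subcube_homogeneous n f (fun i j => (i < P) && (j < P))%N A1 B _
    (fun i => (i < P, P <= i < P + Q))%N (fun t t' => t.1 && t'.1) k k.+1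
    (false, true) (true, false)) => //.
  - by apply/pred0P => i; rewrite /= !inE; lia.
  - by rewrite card_ord_interval ?addKn //; lia.
  - by move=> i; rewrite inE xpair_eqE; lia.
  - by move=> i; rewrite inE xpair_eqE; lia.
pose A2 := [set i : 'I_n | n - Q <= i < n]%N.
(* f is false at this graph, which lies below the previous one because n - Q <= P + Q. Adding the
   biclique gives all edges meeting the first [P] vertices, and n - P < P. *)
apply: (@odd_subcube_homogeneous n f (fun i j => (i < n - Q) && (j < P))%N A2 B _
  (fun i => (i < P, n - Q <= i))%N (fun t t' => ~~ t.2 && t'.1) k k.+1
  (false, true) (true, false)) => //.
- by apply/pred0P => i; rewrite /= !inE; lia.
- by rewrite card_ord_interval // subKn //; lia.
- by apply: contra f2; apply: mkgraph_mono => // i j _; rewrite /biclique !inE; lia.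
- apply: mkgraph_mono f1 => // i j _; rewrite /biclique !inE.
  by have := ltn_ord i; have := ltn_ord j; lia.
- by move=> i j /=; lia.
- by move=> i; rewrite inE xpair_eqE; have := ltn_ord i; lia.
- by move=> i; rewrite inE xpair_eqE; have := ltn_ord i; lia.
Qed.

(** The first [P] vertices are labelled by binary words, so that translations act on them. *)
Let word := {ffun 'I_k.+1 -> bool}.

Let card_word : #|{: word}| = P.
Proof. by rewrite card_ffun card_bool card_ord. Qed.

Let enc_subproof (w : word) : (index w (enum word) < n)%N.
Proof. by apply: leq_trans Pn; rewrite -card_word cardE index_mem mem_enum. Qed.

Let enc (w : word) : 'I_n := Ordinal (enc_subproof w).
(** The default word arises only for vertices beyond the first [P]; every use is guarded against
    these. *)
Let dec (v : 'I_n) : word := nth [ffun=> false] (enum word) v.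

Let enc_lt w : (enc w < P)%N.
Proof. by rewrite -card_word cardE index_mem mem_enum. Qed.

Let encK : cancel enc dec.
Proof. by move=> w; rewrite /dec nth_index ?mem_enum. Qed.

Let decK (v : 'I_n) : (v < P)%N -> enc (dec v) = v.
Proof.
by move=> vP; apply/val_inj; rewrite /= index_uniq ?enum_uniq // -cardE card_word.
Qed.

Let agree i (w w' : word) := [forall j : 'I_k.+1, (i <= j)%N ==> (w j == w' j)].

(* For d = false, 2 ^ (k.+1 - i) disjoint cliques of size 2 ^ i on the first P
   vertices; for d = true, the same joined to a clique on the other ones. *)
Let blocks d i : rel 'I_n := fun u v =>
  if (u < P)%N && (v < P)%N then agree i (dec u) (dec v) else d.

Let half (b : bool) (i : 'I_k.+1) := [set v : 'I_n | (v < P)%N && (dec v i == b)].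

Let card_half b i : #|half b i| = Q.
Proof.
have E b' : #|half b' i| = #|[set w : word | w i == b']|.
  rewrite -(card_imset _ (can_inj encK)); apply: eq_card => v; rewrite inE.
  apply/andP/imsetP => [[vP vb]|[w wb ->]].
    by exists (dec v); rewrite ?inE // decK.
  by rewrite enc_lt encK; move: wb; rewrite inE.
have cubeT : cube [set: 'I_k.+1] [ffun=> false] = [set: word].
  by apply/setP => w; rewrite [RHS]inE; apply/cubeP => e; rewrite inE.
have h : #|half true i| = #|half false i|.
  have := @card_cube_balanced _ setT [ffun=> false] i (fun w : word => w i) (in_setT i).
  rewrite cubeT !E => h; transitivity #|[set w : word | w i]|.
    by apply: eq_card => w; rewrite !inE eqb_id.
  rewrite -[LHS](_ : #|[set x in setT | (x : word) i]| = _); last first.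
    by apply: eq_card => w; rewrite !inE.
  rewrite h => [|w]; last by rewrite ffunE eqxx addbT.
  by apply: eq_card => w; rewrite !inE eqbF_neg.
have : (#|half true i| + #|half false i| = P)%N.
  rewrite !E -card_word -cardsT -(cardsID [set w : word | w i == true] setT).
  by congr (_ + _)%N; apply: eq_card => w; rewrite !inE ?andbT //; case: (w i).
by rewrite h PQ => h2; case: b; rewrite ?h; lia.
Qed.

(** At the first [i.+1] where f becomes true, the new edges join words that differ at coordinate
    [i], so they lie in the biclique between the two halves. *)
Lemma odd_subcube_blocks d :
  ~~ f (mkgraph (blocks d 0)) -> f (mkgraph (blocks d k.+1)) ->
  odd_subcube f (2 ^ (k + k)).
Proof.
move=> f0 f1.
have [i fi0 fi1] : exists2 i : 'I_k.+1, ~~ f (mkgraph (blocks d i)) & f (mkgraph (blocks d i.+1)).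
  have ex : exists i, f (mkgraph (blocks d i)) by exists k.+1.
  case: (ex_minnP ex) => -[|i] fi imin; first by rewrite fi in f0.
  have ik : (i < k.+1)%N by exact: imin.
  by exists (Ordinal ik) => //=; apply/negP => /imin; rewrite ltnn.
have disj : [disjoint half false i & half true i].
  by apply/pred0P => v; rewrite /= !inE; case: (dec v i); rewrite ?andbF.
apply: (odd_subcube_biclique fP fm disj (card_half _ _) (card_half _ _) fi0).
  apply: mkgraph_mono fi1 => // u v _; rewrite /blocks /biclique !inE.
  rewrite [(v < P)%N && (u < P)%N]andbC; case: (u < P)%N; case: (v < P)%N => //=; try by move=> ->.
  move=> /forallP uv; case: (eqVneq (dec u i) (dec v i)) => [e|]; last first.
    by case: (dec u i); case: (dec v i); rewrite ?orbT.
  suff -> : agree i (dec u) (dec v) by [].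
  apply/forallP => j; apply/implyP; rewrite leq_eqVlt => /orP[/eqP/val_inj <-|ij].
    by rewrite e.
  by move: (uv j); rewrite ij.
move=> a a' b b'; rewrite !inE => /andP[aP /eqP ai] /andP[aP' /eqP ai'].
move=> /andP[bP /eqP bi] /andP[bP' /eqP bi'].
(* Each half is translated on its own. Neither translation changes coordinate [i], and words that
   differ there never agree from [i] on, so the blocks are preserved. *)
pose c (w : word) : word := if w i then [ffun j => dec b j (+) dec b' j]
  else [ffun j => dec a j (+) dec a' j].
pose t (w : word) : word := [ffun j => w j (+) c w j].
have ti w : t w i = w i.
  by rewrite ffunE /c; case: (w i); rewrite ffunE ?ai ?ai' ?bi ?bi'.
have tK : involutive t.
  move=> w; have ct : c (t w) = c w by rewrite /c ti.
  by apply/ffunP => j; rewrite [LHS]ffunE ct [t w j]ffunE addbK.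
pose s (v : 'I_n) := if (v < P)%N then enc (t (dec v)) else v.
have sP v : (s v < P)%N = (v < P)%N by rewrite /s; case: ifP => //; rewrite enc_lt.
have sD (v : 'I_n) : (v < P)%N -> dec (s v) = t (dec v) by rewrite /s => ->; rewrite encK.
have sK : involutive s.
  move=> v; have [vP|vP] := boolP (v < P)%N; last by rewrite /s !(negbTE vP).
  by rewrite {1}/s sP vP sD // tK decK.
exists (perm (inv_inj sK)); split.
- rewrite permE -[RHS]decK // /s aP; congr enc; apply/ffunP => j.
  by rewrite ffunE /c ai ffunE addKb.
- rewrite permE -[RHS]decK // /s bP; congr enc; apply/ffunP => j.
  by rewrite ffunE /c bi ffunE addKb.
- move=> v; rewrite permE !inE sP; have [vP|//] := boolP (v < P)%N.
  by rewrite sD // ti.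
- move=> v; rewrite permE !inE sP; have [vP|//] := boolP (v < P)%N.
  by rewrite sD // ti.
move=> u v; rewrite !permE /blocks !sP; case: ifP => // /andP[uP vP].
rewrite !sD //; have [e|ne] := eqVneq (dec u i) (dec v i).
  by apply: eq_forallb => j; rewrite !ffunE /c e (inj_eq (@addIb _)).
apply/idP/idP => /forallP/(_ i); rewrite leqnn ?ti; by rewrite (negbTE ne).
Qed.

(** Three chains are followed: from the empty graph to a clique on [P] vertices, on to all edges
    meeting some n - P vertices, and on to the complete graph. f changes along one of them. *)
Lemma exists_odd_subcube : nontrivial f -> odd_subcube f (2 ^ (k + k)).
Proof.
move=> [x [y fxy]].
have f0 : ~~ f (mkgraph (fun _ _ => false)).
  apply/negP => h; suff fT z : f z by rewrite !fT in fxy.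
  move: h; apply/implyP/fm => e; apply/implyP => /mkgraphP[i [j []]] //.
have f1 : f (mkgraph (fun _ _ => true)).
  apply/negPn/negP => h; suff fF z : f z = false by rewrite !fF in fxy.
  apply: contraNF h; apply/implyP/fm => e; apply/implyP => _.
  have /cards2P[i [j [ij eij]]] := valP e.
  by apply/mkgraphP; exists i, j; rewrite eij !inE !eqxx orbT.
have agree0 (u v : 'I_n) : (u < P)%N -> (v < P)%N -> agree 0 (dec u) (dec v) -> u = v.
  move=> uP vP /forallP h; rewrite -(decK uP) -(decK vP); congr enc.
  by apply/ffunP => j; exact/eqP/(implyP (h j)).
have agreeT w w' : agree k.+1 w w'.
  by apply/forallP => j; rewrite leqNgt ltn_ord.
have [fU|fU] := boolP (f (mkgraph (fun i j => (i < P) && (j < P))%N)).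
  apply: (@odd_subcube_blocks false).
    apply: contra f0; apply: mkgraph_mono => // i j ij; rewrite /blocks.
    by case: ifP => // /andP[iP jP] /agree0 e; rewrite e // eqxx in ij.
  by apply: mkgraph_mono fU => // i j _ h; rewrite /blocks h agreeT.
have [fR|fR] := boolP (f (mkgraph (fun i j => (i < n - P) || (j < n - P))%N)).
  exact: odd_subcube_threshold.
apply: (@odd_subcube_blocks true).
  (* Reversing the vertices moves the n - P dominating ones to the end, where [blocks] has them. *)
  apply: contra fR; rewrite -[X in _ -> is_true X](graph_property_mkgraph (perm (@rev_ord_inj n)) _ fP).
  apply: mkgraph_mono => // i j ij; rewrite /blocks !permE /=.
  case: ifP => [/andP[iP jP] /agree0 e|h _]; first by rewrite e // eqxx in ij.
  by have := ltn_ord i; have := ltn_ord j; move: h; lia.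
by apply: mkgraph_mono f1 => // i j _ _; rewrite /blocks; case: ifP; rewrite ?agreeT.
Qed.
End Cases.

(** * The linear lower bound *)

Lemma nontrivial_gt1 n (f : graph n -> bool) : nontrivial f -> (1 < n)%N.
Proof.
move=> [x [y]]; apply: contraR; rewrite -leqNgt => n1.
suff -> : x = y by [].
apply/ffunP => e; have := max_card (mem (val e)).
by rewrite (eqP (valP e)) card_ord => /leq_trans /(_ n1).
Qed.

Lemma bounded_error_odd_subcube n (f : graph n -> bool) N T :
  (0 < N)%N -> odd_subcube f N -> bounded_error_algorithm f T ->
  Num.sqrt N%:R <= 36 * T%:R :> R.
Proof.
move=> N0 [V [z [NV fodd]]] [m [U [psi0 [out [Uu [psi1 ok]]]]]].
have [v [v0 vpos hv]] := odd_cube_spectral R (leq_trans N0 NV) fodd.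
rewrite -(ler_pM2r vpos); apply: le_trans (adversary_bound Uu psi1 ok v0).
by apply: le_trans hv; rewrite ler_pM2r // ler_wsqrtr // ler_nat.
Qed.

(* Q(f) >= c n, stated as: every T admitting a bounded-error T-query
   algorithm for f satisfies c n <= T (equivalently, the minimum Q(f)). *)
Theorem theorem1p5 :
  exists c : R, 0 < c /\
    forall (n : nat) (f : graph n -> bool),
      graph_property f -> monotone f -> nontrivial f ->
      forall T : nat, bounded_error_algorithm f T -> c * n%:R <= T%:R.
Proof.
(* 144 = 36 * 4: at least 2^(2k) free coordinates give 2^k <= 36 T, while n < 4 * 2^k. *)
exists (144^-1); split; first by lra.
move=> n f fP fm fn T alg; have n1 := nontrivial_gt1 fn.
have lo := trunc_logP (isT : 1 < 2)%N (ltnW n1).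
have hi := trunc_log_ltn n (isT : 1 < 2)%N.
have log1 : (0 < trunc_log 2 n)%N by rewrite trunc_log_gt0.
case: (trunc_log 2 n) log1 lo hi => // k _ lo hi.
have hi' : (n < 2 * 2 ^ k.+1)%N by rewrite -expnS.
have odd := exists_odd_subcube fP fm lo hi' fn.
have := bounded_error_odd_subcube _ odd alg; rewrite expn_gt0 => /(_ isT).
rewrite addnn -muln2 expnM natrX sqrtr_sqr ger0_norm ?ler0n // => h.
have : (n%:R : R) <= 4 * (2 ^ k)%:R.
  by rewrite -natrM ler_nat; move: hi'; rewrite expnS; lia.
lra.
Qed.
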